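(* Let $m \in \mathbb{N}$ with $m \geq 3$, let $t_0, \dotsc, t_{m-1}$ be Boolean variables with arrival times $a : \{t_0, \dotsc, t_{m-1}\} \to \mathbb{N}$, and let $W := \sum_{i=0}^{m-1} 2^{a(t_i)}$. Then there is a Boolean circuit over $\{\land,\lor\}$ realizing the \textsc{And}-\textsc{Or} path $t_0 \land (t_1 \lor (t_2 \land ( \dotsb t_{m-1}) \dotsb ))$ with delay at most \[ \log_2 W + \log_2 \log_2 m + \log_2 \log_2 \log_2 m + 4.3. \]
   Context: The \textsc{And}-\textsc{Or} path $t_0 \land (t_1 \lor (t_2 \land ( \dotsb t_{m-1}) \dotsb ))$ is the function $g(t)$ defined recursively by $g(t) = g^*(t) = t_0$ for $m = 1$ and, for $m>1$, $g(t) = t_0 \land g^*((t_1,\dotsc,t_{m-1}))$, $g^*(t) = t_0 \lor g((t_1,\dotsc,t_{m-1}))$. A Boolean circuit over $\{\land,\lor\}$ is a directed acyclic graph whose indegree-0 nodes (inputs) are labeled by Boolean variables, with a unique outdegree-0 node (output) of indegree 1, and all other nodes are gates of indegree exactly 2 labeled \textsc{And} or \textsc{Or}; it realizes a Boolean function if its output computes that function for all input values. The delay of an input $x$ is $a(x)$ plus the maximum number of gates on any directed path starting at $x$; the delay of the circuit is the maximum delay over its inputs. *)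

(* Defs.v *)
From HB Require Import structures.
From mathcomp Require Import all_boot all_order all_algebra.
From mathcomp Require Import reals exp.

Set Implicit Arguments.
Unset Strict Implicit.
Unset Printing Implicit Defensive.

Import GRing.Theory Num.Theory.

(* For the empty sequence, which the recursion g, g^* does not cover, both
   functions take a junk value. *)
Fixpoint andor_path (t : seq bool) : bool :=
  if t is t0 :: t' then
    if t' is [::] then t0 else t0 && orand_path t'
  else true
with orand_path (t : seq bool) : bool :=
  if t is t0 :: t' then
    if t' is [::] then t0 else t0 || andor_path t'
  else true.

Section Degrees.
Variables (V : finType) (e : rel V).
Definition indegree (v : V) : nat := #|[set u | e u v]|.
Definition outdegree (v : V) : nat := #|[set w | e v w]|.
Definition acyclic : Prop := forall u v, e u v -> ~~ connect e v u.
End Degrees.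

Variant node_label (X : Type) := Input of X | AndGate | OrGate | Output.
Arguments AndGate {X}.
Arguments OrGate {X}.
Arguments Output {X}.

Definition label_indegree (X : Type) (l : node_label X) : nat :=
  match l with Input _ => 0 | AndGate | OrGate => 2 | Output => 1 end.

(* [indegree_label] says at once that the nodes of indegree 0 are exactly the
   inputs and that gates and output have indegree 2 and 1.  Several input nodes
   may carry the same variable. *)
Record circuit (X : Type) := Circuit {
  node : finType;
  edge : rel node;
  label : node -> node_label X;
  output : node;
  edge_acyclic : acyclic edge;
  indegree_label : forall v, indegree edge v = label_indegree (label v);
  label_output : forall v, label v = Output <-> v = output;
  outdegree_output : forall v, outdegree edge v = 0 <-> v = output
}.

Section Circuit.
Variables (X : Type) (C : circuit X).
Implicit Types (v : node C) (x : X -> bool) (a : X -> nat).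

Definition is_gate v : bool :=
  match label v with AndGate | OrGate => true | _ => false end.

(* One evaluation step: the value of [v] given the values [val] of its
   predecessors; the output copies its only predecessor. *)
Definition step x (val : node C -> bool) v : bool :=
  match label v with
  | Input i => x i
  | AndGate => [forall u, edge u v ==> val u]
  | OrGate | Output => [exists u, edge u v && val u]
  end.

(* As the graph is acyclic, #|node C| steps reach the fixpoint, whatever the
   initial values: see [valueE]. *)
Definition value x : node C -> bool :=
  iter #|node C| (step x) (fun=> false).

Definition realizes (f : (X -> bool) -> bool) : Prop :=
  forall x, value x (output C) = f x.

(* Directed paths in an acyclic graph have fewer than #|node C| edges, so this
   is the maximum over all paths starting at [v]: see [max_gates_path]. *)
Definition max_gates v : nat :=
  \max_(n < #|node C|) \max_(p : n.-tuple (node C) | path (@edge X C) v p)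
    count is_gate (v :: p).

Definition delay a : nat :=
  \max_v (if label v is Input i then a i + max_gates v else 0).

Let rank v : nat := #|[set u | connect (@edge X C) u v]|.

Let rank_edge u v : edge u v -> rank u < rank v.
Proof.
move=> uv; apply: proper_card; apply/properP; split.
  apply/subsetP => w; rewrite !inE => wu.
  exact: connect_trans wu (connect1 uv).
exists v; rewrite !inE ?connect0 //; exact: edge_acyclic uv.
Qed.

Lemma valueE x v : value x v = step x (value x) v.
Proof.
have stab k l w : rank w <= k -> rank w <= l ->
    iter k (step x) (fun=> false) w = iter l (step x) (fun=> false) w.
  have rank0 u : 0 < rank u by apply/card_gt0P; exists u; rewrite inE connect0.
  elim: k l w => [|k IH] [|l] w; rewrite ?leqn0 ?(gtn_eqF (rank0 w)) //.
  move=> wk wl; rewrite /= /step.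
  have E u : edge u w ->
      iter k (step x) (fun=> false) u = iter l (step x) (fun=> false) u.
    by move=> /rank_edge uw; apply: IH; rewrite -ltnS; apply: leq_trans uw _.
  case: (label w) => //.
  - by apply: eq_forallb => u; case uw: (edge u w) => //=; rewrite E.
  - by apply: eq_existsb => u; case uw: (edge u w) => //=; rewrite E.
  - by apply: eq_existsb => u; case uw: (edge u w) => //=; rewrite E.
have bnd : rank v <= #|node C| by apply: max_card.
by rewrite {1}/value (stab _ #|node C|.+1) // leqW.
Qed.

Lemma max_gates_path v p :
  path (@edge X C) v p -> count is_gate (v :: p) <= max_gates v.
Proof.
move=> vp; have ltp : size p < #|node C|.
  suff U : uniq (v :: p) by rewrite -(card_uniqP U : _ = (size p).+1) max_card.
  have : sorted (fun u w => rank u < rank w) (v :: p).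
    by apply: sub_path vp => u w; apply: rank_edge.
  apply: sorted_uniq; first by move=> b c d; apply: ltn_trans.
  by move=> u; rewrite /= ltnn.
apply: (leq_trans _ (leq_bigmax (Ordinal ltp))).
exact: (leq_bigmax_cond (in_tuple p)).
Qed.

End Circuit.

Definition log2 (R : realType) (x : R) : R := (ln x / ln 2)%R.

(* Main.v *)
(* Formulas suffice. Consider extended paths f(s, t) = s_0 /\ ... /\ s_(n-1) /\ g(t)
   and let S, T be the total weights 2^(arrival time) of s and t. By induction on
   d, f(s, t) and its dual have delay at most d whenever S + (3 d + 1) T <= 2^d:
   - if S >= 2^(d-1), split off symmetric inputs of weight exactly 2^(d-1) and
     combine them by Kraft's inequality;
   - otherwise use, for a prefix p of t of odd length followed by x, y, q,
       g(p x y q) = g(p) /\ (o \/ x \/ y) /\ ((o \/ x) \/ g^*(q)),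
     where o is the disjunction of the inputs of p at odd positions. The clause
     o \/ x \/ y becomes a symmetric input of the first half. The inputs x, y at
     the cut may be heavy, but they cost only their own weight rather than d
     times it.
   For m >= 32, raising all arrival times to about the logarithm of the average
   weight W / m makes d logarithmic in m; for smaller m the conjunctive normal
   form is fast enough. *)

Require Import Defs.
From mathcomp Require Import all_boot all_order all_algebra.
From mathcomp Require Import reals exp.
From mathcomp Require Import zify lra.

Set Implicit Arguments.
Unset Strict Implicit.
Unset Printing Implicit Defensive.

Import Order.TTheory GRing.Theory Num.Theory.

(** * Formulas and And-Or paths *)

Inductive formula (X : Type) :=
  | Var of X
  | Gate of bool & formula X & formula X.
Arguments Var {X}.

Definition gate_op (b u v : bool) : bool := if b then u && v else u || v.

(* The value of the empty path is neutral for the operation [gate_op (~~ b)] of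
   which it is the last operand. *)
Fixpoint alt_path (b : bool) (t : seq bool) : bool :=
  if t is u :: t' then gate_op b u (alt_path (~~ b) t') else ~~ b.

Definition combine (b : bool) (s : seq bool) : bool :=
  if b then all id s else has id s.

Fixpoint odds (T : Type) (t : seq T) : seq T :=
  if t is _ :: y :: t' then y :: odds t' else [::].

Lemma alt_pathE t : t != [::] ->
  (andor_path t = alt_path true t) * (orand_path t = alt_path false t).
Proof.
elim: t => // u [|v t] IH _; first by rewrite /= andbT orbF.
by have {}IH := IH isT; rewrite /= in IH *; rewrite !IH.
Qed.

Lemma combine_cat b s1 s2 :
  combine b (s1 ++ s2) = gate_op b (combine b s1) (combine b s2).
Proof. by case: b; rewrite /= ?all_cat ?has_cat. Qed.

Lemma combine_cons b u s : combine b (u :: s) = gate_op b u (combine b s).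
Proof. by case: b. Qed.

Lemma combine1 b u : combine b [:: u] = u.
Proof. by case: b; rewrite /= ?andbT ?orbF. Qed.

Lemma odds_map (T U : Type) (f : T -> U) t : odds (map f t) = map f (odds t).
Proof.
have [n le_tn] := ubnP (size t); elim: n t le_tn => // n IH [|x [|y t]] //= lt.
by rewrite IH //; lia.
Qed.

(** For [b = true], peel off [u] and [v]: distributivity turns v \/ (A /\ B) into (v \/ A) /\ (v \/
    B). The first factor rebuilds the path on [p]; the second collects [v] in the disjunction
    guarding [r]. *)
Lemma alt_path_cat b p r : odd (size p) ->
  alt_path b (p ++ r) =
    gate_op b (alt_path b p)
      (gate_op (~~ b) (combine (~~ b) (odds p)) (alt_path (~~ b) r)).
Proof.
have [n le_pn] := ubnP (size p).
elim: n p le_pn => // n IH [|u [|v p]] //= lt; first by case: (b); case: u.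
rewrite !negbK => op; rewrite IH //; last by lia.
rewrite combine_cons.
by case: (b); case: u; case: v => //=; case: (alt_path _ p) => //=;
  rewrite ?orbT ?andbF.
Qed.

Lemma alt_path_split b p x y q : odd (size p) ->
  alt_path b (p ++ x :: y :: q) =
    gate_op b (gate_op b (combine (~~ b) (odds p ++ [:: x; y])) (alt_path b p))
      (gate_op (~~ b) (combine (~~ b) (odds p ++ [:: x])) (alt_path (~~ b) q)).
Proof.
move=> op; rewrite alt_path_cat // !combine_cat !combine_cons.
have -> : alt_path (~~ b) (x :: y :: q) =
    gate_op (~~ b) x (gate_op b y (alt_path (~~ b) q)) by rewrite /= negbK.
move: (combine _ (odds p)) (alt_path b p) (alt_path _ q) => u v w.
by case: b; case: x; case: y; case: u; case: v; case: w.
Qed.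

(** * Formulas, weights and Kraft's inequality *)

Section Formulas.
Variables (X : Type) (a : X -> nat).
Implicit Types (phi : formula X) (s t : seq (formula X)).

Fixpoint eval (x : X -> bool) phi : bool :=
  match phi with
  | Var i => x i
  | Gate b phi1 phi2 => gate_op b (eval x phi1) (eval x phi2)
  end.

Fixpoint fdelay phi : nat :=
  match phi with
  | Var i => a i
  | Gate _ phi1 phi2 => (maxn (fdelay phi1) (fdelay phi2)).+1
  end.

Definition weight s : nat := \sum_(phi <- s) 2 ^ fdelay phi.

Definition realizable (d : nat) (f : (X -> bool) -> bool) : Prop :=
  exists2 phi, fdelay phi <= d & forall x, eval x phi = f x.

Lemma realizable_gate b d f g : realizable d f -> realizable d g ->
  realizable d.+1 (fun x => gate_op b (f x) (g x)).
Proof.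
move=> [phi dphi Ephi] [psi dpsi Epsi]; exists (Gate b phi psi).
  by rewrite /= ltnS geq_max dphi.
by move=> x; rewrite /= Ephi Epsi.
Qed.

Lemma realizable_ext d d' f g : d <= d' -> f =1 g ->
  realizable d f -> realizable d' g.
Proof.
move=> le_d fg [phi dphi Ephi]; exists phi; first exact: leq_trans le_d.
by move=> x; rewrite Ephi fg.
Qed.

Lemma weight_cons phi s : weight (phi :: s) = 2 ^ fdelay phi + weight s.
Proof. exact: big_cons. Qed.

Lemma weight_nil : weight [::] = 0. Proof. exact: big_nil. Qed.

Lemma weight_cat s t : weight (s ++ t) = weight s + weight t.
Proof. exact: big_cat. Qed.

Lemma weight_gt0 s : (0 < weight s) = (0 < size s).
Proof.
by case: s => [|phi s]; rewrite ?weight_nil // weight_cons addn_gt0 expn_gt0.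
Qed.

Lemma weight_odds t : weight (odds t) <= weight t.
Proof.
have [n le_tn] := ubnP (size t).
elim: n t le_tn => // n IH [|x [|y t]] //= lt; first by rewrite weight_nil.
have := IH t; rewrite !weight_cons; lia.
Qed.

(* The quantification over commutative monoids says that [s] is a permutation
   of [s1 ++ s2]. *)
Lemma weight_split d s :
    all (fun phi => fdelay phi <= d) s -> 2 ^ d <= weight s ->
  exists s1 s2, weight s1 = 2 ^ d /\
    forall (T : Type) (idx : T) (op : Monoid.com_law idx) (F : formula X -> T),
      \big[op/idx]_(phi <- s) F phi =
      op (\big[op/idx]_(phi <- s1) F phi) (\big[op/idx]_(phi <- s2) F phi).
Proof.
elim: d s => [|d IH] s le_sd ge_sd.
  case: s le_sd ge_sd => [|phi s] /=; first by rewrite weight_nil.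
  rewrite leqn0 => /andP[/eqP phi0 _] _; exists [:: phi], s; split.
    by rewrite weight_cons weight_nil phi0.
  by move=> T idx op F; rewrite big_cons big_seq1.
(* A member of delay [d.+1] alone has the required weight. Otherwise all delays are at most [d], and
   the induction hypothesis applies twice, each time extracting weight [2 ^ d]. *)
have [/split_find [phi s1 s2 /eqP phid _]|no_top] :=
    boolP (has (fun phi => fdelay phi == d.+1) s).
  exists [:: phi], (s1 ++ s2); split.
    by rewrite weight_cons weight_nil phid addn0.
  move=> T idx op F; rewrite big_seq1 -cats1 !big_cat big_seq1 /=.
  by rewrite Monoid.mulmA; congr (op _ _); rewrite Monoid.mulmC.
have {}le_sd : all (fun phi => fdelay phi <= d) s.
  move: le_sd no_top; elim: (s) => //= phi s' IHs /andP[p1 p2].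
  by rewrite negb_or => /andP[p3 p4]; rewrite IHs // andbT; lia.
have [|s1 [s2 [w1 E1]]] := IH s le_sd; first by rewrite expnS in ge_sd; lia.
have ws := E1 _ _ addn (fun phi => 2 ^ fdelay phi).
have as2 := E1 _ _ andb (fun phi => fdelay phi <= d).
rewrite !big_all le_sd in as2; case/esym/andP: as2 => _ as2.
have [|s3 [s4 [w3 E3]]] := IH s2 as2.
  by move: ge_sd w1; rewrite /weight ws expnS /=; lia.
exists (s1 ++ s3), s4; split; first by rewrite weight_cat w1 w3 expnS mul2n addnn.
by move=> T idx op F; rewrite E1 E3 big_cat Monoid.mulmA.
Qed.

Definition combine_eval b s x : bool := combine b [seq eval x phi | phi <- s].

Lemma combine_eval_split b s s1 s2 :
    (forall (T : Type) (idx : T) (op : Monoid.com_law idx) (F : formula X -> T),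
      \big[op/idx]_(phi <- s) F phi =
      op (\big[op/idx]_(phi <- s1) F phi) (\big[op/idx]_(phi <- s2) F phi)) ->
  forall x, combine_eval b s x =
    gate_op b (combine_eval b s1 x) (combine_eval b s2 x).
Proof.
move=> E x; rewrite /combine_eval /combine; case: b => /=.
  by have := E _ _ andb (eval x); rewrite !big_all !all_map.
by have := E _ _ orb (eval x); rewrite !big_has !has_map.
Qed.

Lemma size_weight s : size s <= weight s.
Proof.
elim: s => // phi s IH; rewrite weight_cons.
by have : 0 < 2 ^ fdelay phi; [rewrite expn_gt0 | move=> /=; lia].
Qed.

(** Every other member weighs at least 1. Hence in a list of two or more, no single member reaches
    the total weight. *)
Lemma fdelay_le_weight s :
  all (fun phi => 2 ^ fdelay phi + size s <= (weight s).+1) s.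
Proof.
elim: s => //= phi s IH; rewrite weight_cons; apply/andP; split.
  by have := size_weight s; lia.
apply: sub_all IH => psi.
by have : 0 < 2 ^ fdelay phi; [rewrite expn_gt0 | lia].
Qed.

(** A list heavier than [2 ^ d] with at least two members contains a part of weight exactly [2 ^ d];
    both parts then fit into depth [d], and one gate joins them. *)
Lemma kraft b s d : 0 < size s -> weight s <= 2 ^ d ->
  realizable d (combine_eval b s).
Proof.
elim: d s => [|d IH] s s_gt0 le_sd.
  case: s s_gt0 le_sd => [|phi [|psi s]] //= _ le.
    rewrite weight_cons weight_nil addn0 -[1]/(2 ^ 0) leq_exp2l // in le.
    by exists phi => // x; rewrite /combine_eval combine1.
  by have := leq_trans (size_weight _) le.
have [small|big] := leqP (weight s) (2 ^ d).
  by apply: realizable_ext (IH s s_gt0 small).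
have [s_gt1|s_le1] := ltnP 1 (size s); last first.
  case: s s_gt0 le_sd {big} s_le1 => [|phi [|psi s]] //= _ le _.
  rewrite weight_cons weight_nil addn0 leq_exp2l // in le.
  by exists phi => // x; rewrite /combine_eval combine1.
have [||s1 [s2 [w1 E]]] := @weight_split d s; last first.
- have ws := E _ _ addn (fun phi => 2 ^ fdelay phi).
  rewrite -!/(weight _) w1 /= in ws; rewrite expnS in le_sd.
  apply: realizable_ext (leqnn _) _ (realizable_gate b (IH s1 _ _) (IH s2 _ _)).
  + by move=> x; rewrite (combine_eval_split b E).
  + by rewrite -weight_gt0 w1 expn_gt0.
  + by rewrite w1.
  + by rewrite -weight_gt0; lia.
  + by lia.
- exact: ltnW.
- apply: sub_all (fdelay_le_weight s) => phi le.
  by rewrite -ltnS -(ltn_exp2l (m := 2)) //; lia.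
Qed.

Definition alt_eval b t x : bool := alt_path b [seq eval x phi | phi <- t].

Definition clause b s : formula X -> Prop := fun phi =>
  fdelay phi <= up_log 2 (weight s) /\ forall x, eval x phi = combine_eval b s x.

Lemma clause_exists b s : 0 < size s -> exists phi, clause b s phi.
Proof.
move=> s_gt0; have [phi dphi Ephi] := kraft b s_gt0 (@up_logP 2 (weight s) isT).
by exists phi.
Qed.

Lemma exp_up_log n : 0 < n -> 2 ^ up_log 2 n <= n.*2.
Proof.
case: n => [|[|n]] // _.
have := @up_log_gtn 2 n.+2 isT isT.
have : 0 < up_log 2 n.+2 by rewrite up_log_gt0.
by case: (up_log 2 n.+2) => // k _; rewrite /= expnS; lia.
Qed.

Lemma clause_weight b s phi : 0 < size s -> clause b s phi ->
  2 ^ fdelay phi <= (weight s).*2.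
Proof.
move=> s_gt0 [dphi _]; apply: leq_trans (exp_up_log _); last by rewrite weight_gt0.
by rewrite leq_exp2l.
Qed.

(** * Few inputs: conjunctive normal form *)

(** For [b = true], [r] holds the disjuncts shared by all remaining clauses: r \/ (u /\ (v \/ g(t)))
    = (r \/ u) /\ ((r \/ v) \/ g(t)) emits one clause and moves [v] into [r]. The factor 2 pays for
    rounding each clause. *)
Lemma normal_form b r t : 0 < size r + size t ->
  exists cl : seq (formula X),
    [/\ 0 < size cl,
        weight cl <= ((size t)./2.+1).*2 * (weight r + weight t) &
        forall x, combine_eval b cl x =
          gate_op (~~ b) (combine_eval (~~ b) r x) (alt_eval b t x)].
Proof.
have [n le_tn] := ubnP (size t).
elim: n r t le_tn => // n IH r [|u [|v t]] /= lt rt_gt0.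
- have [|phi phiP] := @clause_exists (~~ b) r; first by rewrite addn0 in rt_gt0.
  exists [:: phi]; split=> //.
    rewrite weight_cons !weight_nil; have := clause_weight _ phiP; lia.
  move=> x; rewrite /combine_eval /= combine1 phiP.2 /alt_eval /=.
  by rewrite /combine_eval; case: (b); rewrite /= ?orbF ?andbT.
- have [|phi phiP] := @clause_exists (~~ b) (u :: r); first by [].
  exists [:: phi]; split=> //.
    rewrite weight_cons !weight_nil; have := @clause_weight _ (u :: r) phi isT phiP.
    rewrite !weight_cons weight_nil; lia.
  move=> x; rewrite /combine_eval /= combine1 phiP.2 /alt_eval /= /combine_eval.
  by rewrite /= combine_cons; case: (b) => /=; rewrite ?orbF ?andbT (orbC, andbC).
- have [|phi phiP] := @clause_exists (~~ b) (u :: r); first by [].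
  have [||cl [cl_gt0 wcl Ecl]] := IH (v :: r) t; [lia | by [] |].
  exists (phi :: cl); split=> //.
    rewrite weight_cons; have := @clause_weight _ (u :: r) phi isT phiP; move: wcl.
    rewrite !weight_cons; nia.
  move=> x; have := Ecl x; rewrite /combine_eval /= !combine_cons phiP.2 => ->.
  rewrite /combine_eval /alt_eval /= !combine_cons negbK.
  move: (combine _ _) (alt_path _ _) (eval x u) (eval x v) => [] [] [] [];
  by case: (b).
Qed.
End Formulas.

(** * The logarithmic construction *)

(** Growing [p] by two elements keeps its length odd; the search stops at the first failure of [Q]
    or when at most two elements remain. *)
Lemma maximal_odd_prefix (T : Type) (Q : seq T -> seq T -> bool) p r :
    odd (size p) -> Q p r ->
  (exists p1 r1, [/\ p ++ r = p1 ++ r1, odd (size p1), size r1 <= 2 & Q p1 r1]) \/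
  (exists p1 x y r1,
    [/\ p ++ r = p1 ++ [:: x, y & r1], odd (size p1), 0 < size r1,
        Q p1 [:: x, y & r1] & ~~ Q (p1 ++ [:: x; y]) r1]).
Proof.
have [n le_rn] := ubnP (size r).
elim: n p r le_rn => // n IH p r lt op Qpr.
case: (leqP (size r) 2) => [le2|gt2]; first by left; exists p, r.
case: r lt Qpr gt2 => [|x [|y r]] //= lt Qpr gt2.
have [Q1|nQ1] := boolP (Q (p ++ [:: x; y]) r); last by right; exists p, x, y, r.
rewrite -[p ++ _]/(p ++ [:: x; y] ++ r) catA; apply: IH => //; first by lia.
by rewrite size_cat oddD op.
Qed.

Section Construction.
Variables (X : Type) (a : X -> nat).
Implicit Types (phi : formula X) (s t : seq (formula X)).

Definition extended_path b s t x : bool :=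
  gate_op b (combine_eval b s x) (alt_eval b t x).

Lemma extended_path_split b s p q x y phi : odd (size p) ->
    clause a (~~ b) (odds p ++ [:: x; y]) phi ->
  extended_path b s (p ++ [:: x, y & q]) =1 fun v =>
    gate_op b (extended_path b (phi :: s) p v)
              (extended_path (~~ b) (odds p ++ [:: x]) q v).
Proof.
move=> op [_ Ephi] v.
rewrite /extended_path /alt_eval map_cat /= alt_path_split ?size_map //.
rewrite odds_map /combine_eval /= combine_cons Ephi /combine_eval !map_cat /=.
move: (combine _ _) (combine _ _) (combine _ _) (alt_path _ _) (alt_path _ _).
by case: (b) => [] [] [] [] [] [].
Qed.

(** A path on one or two inputs uses a single operation, so all of [r] is absorbed by the clause and
    no second half arises. *)
Lemma extended_path_end b s p r phi : odd (size p) -> 0 < size r <= 2 ->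
    clause a (~~ b) (odds p ++ take 2 r) phi ->
  extended_path b s (p ++ r) =1 extended_path b (phi :: s) p.
Proof.
move=> op size_r [_ Ephi] v.
rewrite /extended_path /alt_eval map_cat alt_path_cat ?size_map //.
rewrite odds_map /combine_eval /= combine_cons Ephi /combine_eval.
rewrite map_cat combine_cat.
have -> : alt_path (~~ b) [seq eval v phi | phi <- r] =
          combine (~~ b) [seq eval v phi | phi <- take 2 r].
  by case: r size_r {Ephi} => [|y [|z [|? ?]]] //= _; rewrite !combine_cons;
    case: (b); do 2 ?case: (eval v _).
move: (combine _ _) (combine _ _) (combine _ _) (alt_path _ _).
by case: (b) => [] [] [] [] [].
Qed.

Lemma extended_path_head b s z t :
  extended_path b s (z :: t) =1 fun v =>
    gate_op b (combine_eval b (z :: s) v) (extended_path (~~ b) [::] t v).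
Proof.
move=> v; rewrite /extended_path /alt_eval /combine_eval /= combine_cons.
by case: (b); case: (combine _ _); case: (eval v z) => //=; rewrite ?andbF ?orbT.
Qed.

Lemma extended_path_nil b t : extended_path b [::] t =1 alt_eval b t.
Proof. by move=> v; rewrite /extended_path /combine_eval; case: b. Qed.

(* When [s] is light, take the longest odd prefix [p] of [t] such that [p],
   together with [s] and the clause formed from [odds p] and the next two
   inputs, still fits into depth [d]. Extending [p] by these two inputs
   overflows, hence the remainder [q] weighs little, and the slack
   [3 * weight t] gained from the factor [3 * d.+1 + 1] dropping to [3 * d + 1]
   pays for the clause (twice its weight, by rounding) and for [odds p]. *)
Lemma extended_path_realizable b d s t : 0 < size t ->
    weight a s + (3 * d + 1) * weight a t <= 2 ^ d ->
  realizable a d (extended_path b s t).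
Proof.
elim: d b s t => [|d IH] b s t t_gt0 le_st.
  have st1 : size s + size t <= 1.
    by have := size_weight a s; have := size_weight a t; lia.
  have s0 : s = [::] by apply/size0nil; lia.
  case: t t_gt0 st1 le_st => [|z [|z' t]] // _ st1; last by move: st1 => /=; lia.
  rewrite s0 weight_nil weight_cons weight_nil => le.
  have := @kraft _ a b [:: z] 0 isT.
  rewrite weight_cons weight_nil => /(_ ltac:(lia)).
  apply: realizable_ext => // v; rewrite extended_path_head.
  rewrite /extended_path /alt_eval /combine_eval.
  by case: (b); rewrite /= ?andbT ?orbF.
have wt_gt0 : 0 < weight a t by rewrite weight_gt0.
rewrite expnS in le_st.
have [s_big|s_small] := leqP (2 ^ d) (weight a s).
  have [|s1 [s2 [w1 E]]] := @weight_split _ a d s _ s_big.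
    (* A delay above [d] would make [s] weigh at least [2 ^ d.+1], leaving no room for the nonempty
       [t]. *)
    apply: sub_all (fdelay_le_weight a s) => phi.
    have [le1|gt1] := leqP (fdelay a phi) d => //.
    have : 2 ^ d.+1 <= 2 ^ fdelay a phi by rewrite leq_exp2l.
    have : 0 < size s by rewrite -(weight_gt0 a) (leq_trans _ s_big) ?expn_gt0.
    by rewrite expnS; nia.
  have ws := E _ _ addn (fun phi => 2 ^ fdelay a phi).
  rewrite -!/(weight a _) w1 /= in ws.
  have s1_gt0 : 0 < size s1 by rewrite -(weight_gt0 a) w1 expn_gt0.
  have := kraft b s1_gt0 (eq_leq w1).
  have /IH H : 0 < size t by [].
  move=> /realizable_gate/(_ (H b s2 _)) H2.
  apply: realizable_ext (leqnn _) _ (H2 b _).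
    move=> v; rewrite /extended_path (combine_eval_split b E).
    by case: (b); rewrite /= ?andbA ?orbA.
  by nia.
case: t t_gt0 le_st wt_gt0 => // z t _ le_st wt_gt0.
pose Q p r := weight a s + 2 ^ up_log 2 (weight a (odds p ++ take 2 r)) +
  (3 * d + 1) * weight a p <= 2 ^ d.
have clause_le p r : 0 < size r ->
    2 ^ up_log 2 (weight a (odds p ++ take 2 r)) <= (weight a (p ++ r)).*2.
  move=> r_gt0; apply: leq_trans (exp_up_log _) _.
    by rewrite weight_gt0 size_cat; case: (r) r_gt0 => //= *; rewrite addnS.
  have := weight_odds a p; have := weight_cat a (take 2 r) (drop 2 r).
  by rewrite cat_take_drop !weight_cat; lia.
have [Q0|] := boolP (Q [:: z] t); last first.
  rewrite /Q -ltnNge => nQ0.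
  case: t le_st wt_gt0 nQ0 => [|y t] le_st wt_gt0 nQ0.
    rewrite weight_cons weight_nil addn0 in le_st.
    have le : weight a (z :: s) <= 2 ^ d.+1 by rewrite weight_cons expnS; nia.
    apply: realizable_ext (leqnn _) _ (@kraft _ a b (z :: s) _ isT le).
    move=> v; rewrite extended_path_head /extended_path /alt_eval /combine_eval.
    by case: (b); rewrite /= ?andbT ?orbF.
  have := clause_le [:: z] (y :: t) isT.
  (* If [z] fits beside [s], these form one half, and the overflow of [Q] shows that the path on the
     rest fits into the other. If not, [s] and [z] together exceed [2 ^ d], so the whole path
     without [s] fits. *)
  have [le_sz|gt_sz] := leqP (2 ^ fdelay a z + weight a s) (2 ^ d) => cl.
    have H1 : realizable a d (combine_eval b (z :: s)).
      by apply: kraft => //; rewrite weight_cons.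
    have H2 : realizable a d (extended_path (~~ b) [::] (y :: t)).
      apply: IH => //; move: nQ0 cl le_st; rewrite !weight_cons weight_nil; nia.
    apply: realizable_ext (leqnn _) _ (realizable_gate b H1 H2) => v.
    by rewrite -extended_path_head.
  have H2 : realizable a d (extended_path b [::] (z :: y :: t)).
    apply: IH => //; move: le_st gt_sz; rewrite !weight_cons weight_nil; nia.
  have [s0|s_gt0] := posnP (size s).
    by rewrite (size0nil s0); apply: realizable_ext H2.
  have H1 := kraft b s_gt0 (ltnW s_small).
  apply: realizable_ext (leqnn _) _ (realizable_gate b H1 H2).
  by move=> v; rewrite extended_path_nil.
have [[p [r [def_t op size_r Qpr]]]|] :=
    @maximal_odd_prefix _ Q [:: z] t isT Q0.
  rewrite -[z :: t]/([:: z] ++ t) def_t.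
  have p_gt0 : 0 < size p by case: (p) op.
  have [r0|r_gt0] := posnP (size r).
    rewrite (size0nil r0) cats0; apply: realizable_ext (leqnSn d) (frefl _) _.
    by apply: IH => //; move: Qpr; rewrite /Q; lia.
  have [|phi phiP] := @clause_exists _ a (~~ b) (odds p ++ take 2 r).
    by rewrite size_cat; case: (r) r_gt0 => //= *; rewrite addnS.
  apply: realizable_ext (leqnSn d) _ (IH b (phi :: s) p p_gt0 _).
    by move=> v; rewrite (extended_path_end _ op _ phiP) // r_gt0.
  have := phiP.1; rewrite -(leq_exp2l (m := 2)) // weight_cons.
  by move: Qpr; rewrite /Q; lia.
move=> [p [x [y [q [def_t op q_gt0 Qp nQp]]]]].
rewrite -[z :: t]/([:: z] ++ t) def_t in le_st wt_gt0 *.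
have [|phi phiP] := @clause_exists _ a (~~ b) (odds p ++ [:: x; y]).
  by rewrite size_cat addnS.
have H1 : realizable a d (extended_path b (phi :: s) p).
  apply: IH; first by case: (p) op.
  have := phiP.1; rewrite -(leq_exp2l (m := 2)) // weight_cons.
  by move: Qp; rewrite /Q /= take0; lia.
(* Let S, P, x, y, q denote weights. The overflow and [clause_le] give 2^d < S + 2 (P + x + y + q) +
   (3 d + 1) (P + x + y). Subtracting this from S + (3 d + 4) (P + x + y + q) <= 2 * 2^d leaves P +
   x + y + (3 d + 2) q < 2^d, which suffices. *)
have H2 : realizable a d (extended_path (~~ b) (odds p ++ [:: x]) q).
  apply: IH => //; rewrite /Q -ltnNge in nQp.
  have := clause_le (p ++ [:: x; y]) q q_gt0; have := weight_odds a p.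
  move: nQp le_st; rewrite !(weight_cat, weight_cons, weight_nil); nia.
apply: realizable_ext (leqnn _) _ (realizable_gate b H1 H2) => v.
by rewrite (extended_path_split _ _ op phiP).
Qed.
End Construction.

(** * Formulas as circuits *)

Lemma sum_option (T : finType) (F : option T -> nat) :
  \sum_u F u = F None + \sum_u F (Some u).
Proof.
rewrite (bigD1 None) //= (reindex_omap Some id) => [|[]//].
by congr (_ + _); apply: eq_bigl => u; rewrite eqxx.
Qed.

Section CircuitOfFormula.
Variable X : Type.
Implicit Types phi : formula X.

(** One node per subformula occurrence, [None] being the top gate; nothing is shared, so the graph
    is a tree. *)
Fixpoint tnode phi : finType :=
  match phi with
  | Var _ => unit
  | Gate _ phi1 phi2 => option (tnode phi1 + tnode phi2)%type
  end.

(* The parent [None] stands for the node that reads the value of the formula: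
   the parent gate in a larger formula, or the output of the circuit. *)
Fixpoint parent phi : tnode phi -> option (tnode phi) :=
  match phi return tnode phi -> option (tnode phi) with
  | Var _ => fun _ => None
  | Gate _ phi1 phi2 => fun u =>
    match u with
    | None => None
    | Some (inl u1) => Some (omap inl (parent u1))
    | Some (inr u2) => Some (omap inr (parent u2))
    end
  end.

Fixpoint tlabel phi : tnode phi -> node_label X :=
  match phi return tnode phi -> node_label X with
  | Var i => fun _ => Input i
  | Gate b phi1 phi2 => fun u =>
    match u with
    | None => if b then AndGate else OrGate
    | Some (inl u1) => tlabel u1
    | Some (inr u2) => tlabel u2
    end
  end.

(** Distance to the output, including the edge from the root to the output. *)
Fixpoint height phi : tnode phi -> nat :=
  match phi return tnode phi -> nat with
  | Var _ => fun _ => 1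
  | Gate _ phi1 phi2 => fun u =>
    match u with
    | None => 1
    | Some (inl u1) => (height u1).+1
    | Some (inr u2) => (height u2).+1
    end
  end.

Definition cnode phi : finType := option (tnode phi).

Definition cedge phi (u v : cnode phi) : bool :=
  if u is Some u' then parent u' == v else false.

Definition clabel phi (u : cnode phi) : node_label X :=
  if u is Some u' then tlabel u' else Output.

Definition cheight phi (u : cnode phi) : nat :=
  if u is Some u' then height u' else 0.

Lemma height_parent phi (u : tnode phi) : height u = (cheight (parent u)).+1.
Proof.
elim: phi u => //= b phi1 IH1 phi2 IH2 [[u|u]|] //.
  by rewrite IH1; case: (parent u).
by rewrite IH2; case: (parent u).
Qed.

Lemma cheight_edge phi (u v : cnode phi) : cedge u v -> cheight u = (cheight v).+1.
Proof. by case: u => //= u /eqP <-; apply: height_parent. Qed.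

Lemma cedge_acyclic phi : acyclic (@cedge phi).
Proof.
move=> u v /cheight_edge huv; apply/negP => /connectP[p vp last_p].
suff : cheight u <= cheight v by rewrite huv ltnn.
rewrite {}last_p {u huv}; elim: p v vp => //= w p IH v /andP[/cheight_edge -> vp].
exact: leqW (IH _ vp).
Qed.

Lemma tlabel_neq_output phi (u : tnode phi) : tlabel u <> Output.
Proof. by elim: phi u => //= -[] phi1 IH1 phi2 IH2 [[u|u]|] //. Qed.

(** As a sum, the indegree splits over the two operands. Each operand contributes 1 at its own
    output, hence 2 at the gate joining them. *)
Lemma sum_parent phi (v : cnode phi) :
  \sum_(u : tnode phi) (parent u == v) = label_indegree (clabel v).
Proof.
elim: phi v => [i|b phi1 IH1 phi2 IH2] v.
  rewrite (bigD1 tt) //= big1 ?addn0; last by case.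
  by case: v => [[]|].
rewrite sum_option big_sumType /=.
have E1 u w : (Some (omap inl (parent u)) == Some (Some (inl w))
    :> cnode (Gate b phi1 phi2)) = (parent u == Some w).
  by case: (parent u).
have E2 u w : (Some (omap inr (parent u)) == Some (Some (inr w))
    :> cnode (Gate b phi1 phi2)) = (parent u == Some w).
  by case: (parent u).
case: v => [[[w|w]|]|].
- under eq_bigr do rewrite E1.
  by rewrite IH1 [X in _ + (_ + X)]big1 ?addn0 // => u _; case: (parent u).
- rewrite [X in _ + (X + _)]big1; last by move=> u _; case: (parent u).
  by under eq_bigr do rewrite E2; rewrite IH2.
- transitivity (0 + (\sum_(u : tnode phi1) (parent u == None) +
                     \sum_(u : tnode phi2) (parent u == None))).
    by congr (_ + (_ + _)); apply: eq_bigr => u _; case: (parent u).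
  by rewrite IH1 IH2; case: (b).
- by rewrite !big1.
Qed.

Lemma indegree_clabel phi (v : cnode phi) :
  indegree (@cedge phi) v = label_indegree (clabel v).
Proof.
rewrite /indegree cardsE -sum1_card big_mkcond sum_option /= -sum_parent.
by apply: eq_bigr => u _; rewrite unfold_in /=; case: eqP.
Qed.

Lemma clabel_output phi (v : cnode phi) : clabel v = Output <-> v = None.
Proof. by case: v => // u; split=> // /tlabel_neq_output. Qed.

Lemma outdegree_cedge phi (v : cnode phi) :
  outdegree (@cedge phi) v = 0 <-> v = None.
Proof.
rewrite /outdegree; split=> [/eqP|->]; last first.
  by apply/eqP; rewrite cards_eq0; apply/eqP/setP => w; rewrite !inE.
case: v => // u; rewrite cards_eq0 => /eqP/setP/(_ (parent u)).
by rewrite !inE /= eqxx.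
Qed.

Definition formula_circuit phi : circuit X :=
  Circuit (@cedge_acyclic phi) (@indegree_clabel phi) (@clabel_output phi)
    (@outdegree_cedge phi).

Definition root phi : tnode phi :=
  match phi return tnode phi with Var _ => tt | Gate _ _ _ => None end.

Lemma parent_root phi : parent (root phi) = None.
Proof. by case: phi. Qed.

(** Stated for any solution [val] of the evaluation equations, so that the induction can restrict
    [val] to each operand. *)
Lemma root_value phi (x : X -> bool) (val : tnode phi -> bool) :
    (forall u, val u =
      match tlabel u with
      | Input i => x i
      | AndGate => [forall w, (parent w == Some u) ==> val w]
      | OrGate | Output => [exists w, (parent w == Some u) && val w]
      end) ->
  forall u, parent u = None -> val u = eval x phi.
Proof.
elim: phi val => [i|b phi1 IH1 phi2 IH2] val Hval u pu; first by rewrite Hval.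
have {}IH1 : forall u, parent u = None -> val (Some (inl u)) = eval x phi1.
  apply: (IH1 (fun u => val (Some (inl u)))) => v; rewrite Hval /=.
  case: (tlabel v) => //.
  - apply/forallP/forallP => [H w|H [[w|w]|]] //=.
    + by have /= := H (Some (inl w)); case: (parent w).
    + by have /= := H w; case: (parent w).
    + by case: (parent w).
  - apply/existsP/existsP => [[[[w|w]|]] //=|[w H]].
    + by move=> H; exists w; move: H; case: (parent w).
    + by case: (parent w).
    + by exists (Some (inl w)); move: H => /=; case: (parent w).
  - apply/existsP/existsP => [[[[w|w]|]] //=|[w H]].
    + by move=> H; exists w; move: H; case: (parent w).
    + by case: (parent w).
    + by exists (Some (inl w)); move: H => /=; case: (parent w).
have {}IH2 : forall u, parent u = None -> val (Some (inr u)) = eval x phi2.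
  apply: (IH2 (fun u => val (Some (inr u)))) => v; rewrite Hval /=.
  case: (tlabel v) => //.
  - apply/forallP/forallP => [H w|H [[w|w]|]] //=.
    + by have /= := H (Some (inr w)); case: (parent w).
    + by case: (parent w).
    + by have /= := H w; case: (parent w).
  - apply/existsP/existsP => [[[[w|w]|]] //=|[w H]].
    + by case: (parent w).
    + by move=> H; exists w; move: H; case: (parent w).
    + by exists (Some (inr w)); move: H => /=; case: (parent w).
  - apply/existsP/existsP => [[[[w|w]|]] //=|[w H]].
    + by case: (parent w).
    + by move=> H; exists w; move: H; case: (parent w).
    + by exists (Some (inr w)); move: H => /=; case: (parent w).
have child w : parent w = Some (None : tnode (Gate b phi1 phi2)) ->
    val w = eval x phi1 \/ val w = eval x phi2.
  case: w => [[w|w]|] //=; case pw: (parent w) => //= _; [left|right].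
    exact: IH1.
  exact: IH2.
case: u pu => [[u|u]|] //= _; rewrite Hval /=; case: (b); rewrite /=.
  apply/forallP/andP => [H|[H1 H2] w].
    have := H (Some (inl (root phi1))); have := H (Some (inr (root phi2))).
    by rewrite /= !parent_root /= IH1 ?IH2 ?parent_root.
  by apply/implyP => /eqP/child[] ->.
apply/existsP/orP => [[w /andP[/eqP/child[] ->]]|[]]; [by left|by right| |] => H.
  by exists (Some (inl (root phi1))); rewrite /= parent_root IH1 ?parent_root ?eqxx.
by exists (Some (inr (root phi2))); rewrite /= parent_root IH2 ?parent_root ?eqxx.
Qed.

Lemma realizes_formula phi : realizes (formula_circuit phi) (fun x => eval x phi).
Proof.
move=> x; have rv : forall u, parent u = None ->
    value (C := formula_circuit phi) x (Some u) = eval x phi.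
  apply: root_value => u; rewrite valueE /step /=.
  case: (tlabel u) => //.
  - by apply/forallP/forallP => [H w|H [w|]] //=; have := H (Some w).
  - apply/existsP/existsP => [[[w|] //= H]|[w H]]; first by exists w.
    by exists (Some w).
  - apply/existsP/existsP => [[[w|] //= H]|[w H]]; first by exists w.
    by exists (Some w).
rewrite valueE /step /=.
apply/existsP/idP => [[[u|] //= /andP[/eqP pu]]|H]; first by rewrite rv.
by exists (Some (root phi)); rewrite /= parent_root rv ?parent_root.
Qed.

Lemma fdelay_height (a : X -> nat) phi (u : tnode phi) i :
  tlabel u = Input i -> a i + (height u).-1 <= fdelay a phi.
Proof.
elim: phi u => [j u [->]|b phi1 IH1 phi2 IH2 [[u|u]|]] //=; first by rewrite addn0.
- by move/IH1; rewrite (height_parent u) /= addnS ltnS leq_max => ->.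
- by move/IH2; rewrite (height_parent u) /= addnS ltnS leq_max orbC => ->.
- by case: b.
Qed.

Lemma delay_formula (a : X -> nat) phi :
  delay (formula_circuit phi) a <= fdelay a phi.
Proof.
pose C := formula_circuit phi.
(* Each edge lowers [cheight] by one, and the output, at height 0, is not a gate. *)
have path_le (v : node C) p : path (@edge X C) v p ->
    count (@is_gate X C) (v :: p) <= cheight v.
  elim: p v => [|w p IH] v /=; first by
    case: v => //= u; rewrite height_parent; case: (is_gate _).
  move=> /andP[/cheight_edge -> /IH /= H]; case: (is_gate v) => //; exact: leqW.
apply/bigmax_leqP => v _; case: v => [u|] //=; case lu: (tlabel u) => [i|||] //.
apply: leq_trans (fdelay_height a lu); rewrite leq_add2l.
apply/bigmax_leqP => n _; apply/bigmax_leqP => -[[|w p] /= _].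
  by rewrite /is_gate /= lu.
move=> /andP[/eqP pu /path_le H].
by rewrite {1}/is_gate /= lu height_parent pu.
Qed.

End CircuitOfFormula.

(** * Choice of the construction *)

Section PathOfInputs.
Variable X : Type.

Lemma realizable_shift (a a' : X -> nat) K d f : (forall i, a i <= a' i + K) ->
  realizable a' d f -> realizable a (d + K) f.
Proof.
move=> le_a [phi dphi Ephi]; exists phi => //.
suff : fdelay a phi <= fdelay a' phi + K by lia.
by elim: (phi) => //= b phi1 IH1 phi2 IH2; lia.
Qed.

Lemma weight_Var (a : X -> nat) (t : seq X) :
  weight a [seq Var i | i <- t] = \sum_(i <- t) 2 ^ a i.
Proof. by rewrite /weight big_map. Qed.

Lemma few_inputs (a : X -> nat) b (t : seq (formula X)) d : 0 < size t ->
    ((size t)./2.+1).*2 * weight a t <= 2 ^ d ->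
  realizable a d (alt_eval b t).
Proof.
move=> t_gt0 le_d; have [//|cl [cl_gt0 wcl Ecl]] := @normal_form _ a b [::] t.
rewrite weight_nil in wcl.
apply: realizable_ext (leqnn d) _ (kraft b cl_gt0 (leq_trans wcl le_d)).
by move=> x; rewrite Ecl -/(extended_path _ _ _ _) /combine_eval; case: (b).
Qed.

Lemma exp2_ge_linear e : 8 <= e -> 24 * e + 64 <= 2 ^ e.
Proof.
elim: e => // e IH; rewrite leq_eqVlt => /predU1P[[<-] //|].
by rewrite ltnS expnS => /IH; lia.
Qed.

(** Here 12 e + 4 = 4 (3 e + 1): the depth factor, doubled for raising arrival times and again for
    rounding [d] down. For f = e - l - 2 > 0, 2^f < N makes f logarithmic in [N]. *)
Lemma shifted_depth_bound N l e : 190 <= N -> 38 * l <= N ->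
  2 ^ e < N * 2 ^ l.+2 -> 12 * e + 4 <= N.
Proof.
move=> N_ge lN; have [|lt_le] := leqP e l.+2; first by lia.
rewrite -(subnK (ltnW lt_le)) expnD ltn_pmul2r ?expn_gt0 // => lt_N.
have [/exp2_ge_linear|] := leqP 8 (e - l.+2); lia.
Qed.

(* Raising all arrival times to at least [K], where [2 ^ K] is about the average
   weight, at most doubles the total weight; after subtracting [K] the depth is
   logarithmic in the number of inputs instead of in the total weight. *)
Lemma many_inputs (a : X -> nat) b (t : seq X) N d :
    0 < size t -> 190 <= N -> 38 * trunc_log 2 (size t) <= N ->
    2 ^ d <= N * \sum_(i <- t) 2 ^ a i < 2 ^ d.+1 ->
  realizable a d (alt_eval b [seq Var i | i <- t]).
Proof.
move=> t_gt0 N_ge lN; set W := \sum_(i <- t) _ => /andP[le_d lt_d].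
set m := size t in t_gt0 lN.
have mW : m <= W.
  by have := size_weight a [seq Var i | i <- t]; rewrite weight_Var size_map.
pose K := trunc_log 2 (W %/ m).
have [leK ltK] : 2 ^ K * m <= W /\ W < 2 ^ K.+1 * m.
  have q_gt0 : 0 < W %/ m by rewrite divn_gt0.
  split; first by rewrite -leq_divRL // trunc_logP.
  by rewrite -ltn_divLR // trunc_log_ltn.
have leKd : K <= d.
  rewrite -ltnS -(ltn_exp2l (m := 2)) //; apply: leq_ltn_trans lt_d.
  by nia.
have lt_m : m < 2 ^ (trunc_log 2 m).+1 by apply: trunc_log_ltn.
have dE : 2 ^ d = 2 ^ (d - K) * 2 ^ K by rewrite -expnD subnK.
have K_gt0 : 0 < 2 ^ K by rewrite expn_gt0.
have bound : 12 * (d - K) + 4 <= N.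
  apply: (shifted_depth_bound N_ge lN).
  rewrite -(ltn_pmul2r K_gt0) -dE; apply: leq_ltn_trans le_d _.
  rewrite expnS in ltK; rewrite expnS.
  apply: (@leq_trans (N * (2 * 2 ^ K * m))); first by rewrite ltn_pmul2l //; lia.
  rewrite [X in _ <= X](_ : _ = N * (2 * 2 ^ K * 2 ^ (trunc_log 2 m).+1));
    last by lia.
  by rewrite leq_mul2l leq_mul2l (ltnW lt_m) !orbT.
rewrite -(subnK leKd); apply: (realizable_shift (a' := fun i => a i - K)).
  by lia.
apply: realizable_ext (leqnn _) (@extended_path_nil _ b _) _.
apply: extended_path_realizable; rewrite ?size_map // weight_nil add0n weight_Var.
rewrite -(leq_pmul2r K_gt0) -dE.
(* Subtraction truncates, so [a i - K + K] is the maximum of [a i] and [K]; its power of 2 is at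
   most [2 ^ a i + 2 ^ K]. *)
have le2 : (\sum_(i <- t) 2 ^ (a i - K)) * 2 ^ K <= 2 * W.
  apply: (@leq_trans (W + 2 ^ K * m)); last by lia.
  rewrite big_distrl /= /W /m -sum1_size big_distrr -big_split /=.
  apply: leq_sum => i _; rewrite -expnD muln1.
  have [le|/ltnW gt] := leqP K (a i); first by rewrite subnK // leq_addr.
  by rewrite (eqP gt) leq_addl.
rewrite expnS in lt_d; nia.
Qed.
End PathOfInputs.

(** * Binary logarithms and the numerical budget *)

Section Log2.
Variable R : realType.
Local Open Scope ring_scope.
Implicit Types x y : R.

Lemma ln2_gt0 : 0 < ln (2 : R).
Proof. by apply: ln_gt0; rewrite ltr1n. Qed.

Lemma ler_log2 x y : 0 < x -> x <= y -> log2 x <= log2 y.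
Proof.
move=> x0 xy; rewrite /log2 ler_pM2r ?invr_gt0 ?ln2_gt0 // ler_ln // posrE //.
exact: lt_le_trans xy.
Qed.

Lemma log2M x y : 0 < x -> 0 < y -> log2 (x * y) = log2 x + log2 y.
Proof. by move=> x0 y0; rewrite /log2 lnM ?posrE // mulrDl. Qed.

Lemma log2X n x : 0 < x -> log2 (x ^+ n) = n%:R * log2 x.
Proof. by move=> x0; rewrite /log2 lnXn // mulrA mulr_natl. Qed.

Lemma log2_2 : log2 (2 : R) = 1.
Proof. by rewrite /log2 divff // gt_eqF // ln2_gt0. Qed.

Lemma log2_exp2 n : log2 ((2 ^ n)%N%:R : R) = n%:R.
Proof. by rewrite natrX log2X ?ltr0n // log2_2 mulr1. Qed.

Lemma trunc_log_le_log2 m : (0 < m)%N -> (trunc_log 2 m)%:R <= log2 (m%:R : R).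
Proof.
move=> m0; rewrite -[leLHS]log2_exp2; apply: ler_log2.
  by rewrite ltr0n expn_gt0.
by rewrite ler_nat trunc_logP.
Qed.

Lemma log2_le_ratio (n p q : nat) : (0 < n)%N -> (0 < q)%N -> (n ^ q <= 2 ^ p)%N ->
  log2 (n%:R : R) <= p%:R / q%:R.
Proof.
move=> n0 q0 le; rewrite ler_pdivlMr ?ltr0n // mulrC -log2X ?ltr0n //.
by rewrite -natrX -[leRHS]log2_exp2 ler_log2 ?ltr0n ?expn_gt0 ?n0 // ler_nat.
Qed.

(** The final depth is the rounded-down logarithm of [N] times the total weight. The two
    alternatives are what [few_inputs] and [many_inputs] need from [N]. *)
Lemma log2_budget m : (3 <= m)%N -> exists N : nat,
  log2 (N%:R : R) <= log2 (log2 m%:R) + log2 (log2 (log2 m%:R)) + 43%:R / 10%:R /\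
  (4 * (m./2.+1) <= N \/ 190 <= N /\ 38 * trunc_log 2 m <= N)%N.
Proof.
rewrite leq_eqVlt => /predU1P[<-|m_gt3].
  (* For m = 3 the rounded iterated logarithm is 0, so the general choice of [N] would vanish. *)
  exists 8%N; split; last by left.
  have H1 : 3%:R / 2%:R <= log2 (3%:R : R).
    rewrite ler_pdivrMr ?ltr0n // mulrC -log2X ?ltr0n // -[leLHS]log2_exp2.
    by rewrite -natrX ler_log2 ?ltr0n // ler_nat.
  have H2 : 1 / 2%:R <= log2 (3%:R / 2%:R : R).
    rewrite ler_pdivrMr ?ltr0n // mulrC -log2X ?divr_gt0 ?ltr0n // -[leLHS]log2_2.
    apply: ler_log2; first by [].
    by rewrite expr2; lra.
  have H3 : log2 (1 / 2%:R : R) = - 1.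
    have half_gt0 : 0 < 1 / 2%:R :> R by lra.
    have := log2M half_gt0 (ltr0Sn R 1); rewrite divfK ?pnatr_eq0 // log2_2.
    by rewrite {1}/log2 ln1 mul0r; lra.
  have H4 : log2 (8%:R : R) = 3%:R by exact: (log2_exp2 3).
  have H5 : log2 (3%:R / 2%:R : R) <= log2 (log2 3%:R) by apply: ler_log2 => //; lra.
  have H6 : log2 (1 / 2%:R : R) <= log2 (log2 (log2 3%:R)) by apply: ler_log2; lra.
  by rewrite H4; lra.
have m_gt0 : (0 < m)%N by lia.
set l := trunc_log 2 m; set k := trunc_log 2 l.
have l_ge2 : (2 <= l)%N by apply: trunc_log_max.
have k_ge1 : (1 <= k)%N by apply: trunc_log_max.
(* 19 is the largest integer below 2^4.3. *)
exists (19 * (l * k))%N; split; last first.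
  have [m_lt32|m_ge32] := ltnP m 32.
    left; have [m_lt16|m_ge16] := ltnP m 16; first by nia.
    have l_ge4 : (4 <= l)%N by apply: trunc_log_max.
    have k_ge2 : (2 <= k)%N by apply: trunc_log_max.
    by nia.
  have l_ge5 : (5 <= l)%N by apply: trunc_log_max.
  have k_ge2 : (2 <= k)%N by apply: trunc_log_max => //; lia.
  by right; split; nia.
have ll : l%:R <= log2 (m%:R : R) by apply: trunc_log_le_log2.
have l_gt0 : 0 < l%:R :> R by rewrite ltr0n; lia.
have kk : k%:R <= log2 (log2 (m%:R : R)).
  by apply: (le_trans (trunc_log_le_log2 _)); [lia | apply: ler_log2].
have k_gt0 : 0 < k%:R :> R by rewrite ltr0n.
have H19 : log2 (19%:R : R) <= 43%:R / 10%:R.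
  (* 19^4 = 130321 <= 131072 = 2^17. *)
  have : log2 (19%:R : R) <= 17%:R / 4%:R by apply: log2_le_ratio.
  lra.
have H1 := ler_log2 l_gt0 ll; have H2 := ler_log2 k_gt0 kk.
have lk_gt0 : 0 < l%:R * k%:R :> R by rewrite mulr_gt0.
rewrite !natrM (log2M (ltr0Sn _ _) lk_gt0) (log2M l_gt0 k_gt0); lra.
Qed.

End Log2.

Theorem theorem4p1 (R : realType) (m : nat) (hm : 3 <= m) (a : 'I_m -> nat) :
  let W : nat := \sum_(i < m) 2 ^ a i in
  exists C : circuit 'I_m,
    realizes C (fun t : 'I_m -> bool => andor_path [seq t i | i <- enum 'I_m]) /\
    ((delay C a)%:R <=
       log2 W%:R + log2 (log2 m%:R) + log2 (log2 (log2 m%:R)) + 43%:R / 10%:R :> R)%R.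
Proof.
move=> W; have [N [budget large]] := log2_budget R hm.
have WE : W = \sum_(i <- enum 'I_m) 2 ^ a i by rewrite big_enum.
have W_gt0 : 0 < W.
  by rewrite /W (bigD1 (Ordinal (ltnW (ltnW hm)))) //= addn_gt0 expn_gt0.
have N_gt0 : 0 < N by lia.
have NW_gt0 : 0 < N * W by rewrite muln_gt0 N_gt0.
(* Rounding down keeps [d] within log2 N + log2 W; the factor 2 lost is provided for in [large]. *)
pose d := trunc_log 2 (N * W).
have [le_d lt_d] : 2 ^ d <= N * W /\ N * W < 2 ^ d.+1.
  by rewrite trunc_logP // trunc_log_ltn.
have size_t : size (enum 'I_m) = m by rewrite size_enum_ord.
have [phi dphi Ephi] : realizable a d (alt_eval true [seq Var i | i <- enum 'I_m]).
  case: large => [large|[N_ge lN]].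
    apply: few_inputs; rewrite size_map size_t; first by lia.
    rewrite weight_Var -WE; rewrite expnS in lt_d; nia.
  apply: (@many_inputs _ a true _ N d); rewrite ?size_t -?WE //; first by lia.
  by rewrite le_d.
exists (formula_circuit phi); split.
  move=> x; rewrite realizes_formula Ephi /alt_eval -map_comp (alt_pathE _).1 //.
  by rewrite -size_eq0 size_map size_t; lia.
have dC : delay (formula_circuit phi) a <= d := leq_trans (delay_formula a phi) dphi.
have N0 : (0 < N%:R :> R)%R by rewrite ltr0n.
have W0 : (0 < W%:R :> R)%R by rewrite ltr0n.
have dle : (d%:R <= log2 (N%:R : R) + log2 W%:R :> R)%R.
  by rewrite -log2M // -natrM -log2_exp2 ler_log2 ?ltr0n ?expn_gt0 // ler_nat.
have dC' : ((delay (formula_circuit phi) a)%:R <= d%:R :> R)%R by rewrite ler_nat.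
by apply: (le_trans dC'); lra.
Qed.
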